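(* Let $A$ be a commutative ring with $1$ and let $M\in\operatorname{Sym}_n(A)$ be positive definite. Then there exist $s\in\Sigma A^2$ and $Q\in\operatorname{Mat}_{m,n}(A)$ with $m\le 2np(A)$ such that $sM=\mathrm{I}_n+Q^{t}Q$.
   Context: $\Sigma A^2$ denotes the set of finite sums of squares of elements of $A$. $\operatorname{Mat}_{m,n}(A)$ is the set of $m\times n$ matrices over $A$ and $\operatorname{Sym}_n(A)$ the set of symmetric $n\times n$ matrices over $A$. A matrix $M\in\operatorname{Sym}_n(A)$ is positive definite if for every ring homomorphism $\varphi:A\to R$ into a real closed field $R$, the matrix $\varphi(M)$ (entrywise image) is positive definite over $R$ (vacuous if there is no such $\varphi$). The Pythagoras number $p(A)$ is the smallest integer $q$ such that every element of $\Sigma A^2$ is a sum of $q$ squares in $A$; $p(A)=\infty$ if no such integer exists (then the bound on $m$ is vacuous). *)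

(* Defs.v *)
From HB Require Import structures.
From mathcomp Require Import all_boot all_order all_algebra.
Set Implicit Arguments. Unset Strict Implicit. Unset Printing Implicit Defensive.
Import Order.TTheory GRing.Theory Num.Theory.
Local Open Scope ring_scope.

Definition sum_of_squares (A : comPzRingType) (s : A) : Prop :=
  exists l : seq A, s = \sum_(x <- l) x ^+ 2.

Definition sum_of_q_squares (A : comPzRingType) (q : nat) (s : A) : Prop :=
  exists f : 'I_q -> A, s = \sum_(i < q) f i ^+ 2.

Definition pyth_bound (A : comPzRingType) (q : nat) : Prop :=
  forall s : A, sum_of_squares s -> sum_of_q_squares q s.

(* p is the Pythagoras number p(A) (finite case): the smallest such q.
   If no such q exists, p(A) = infinity and no p satisfies this predicate. *)
Definition is_pythagoras_number (A : comPzRingType) (p : nat) : Prop :=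
  pyth_bound A p /\ forall q, pyth_bound A q -> (p <= q)%N.

Definition symmetric_mx (A : comPzRingType) (n : nat) (M : 'M[A]_n) : Prop :=
  M^T = M.

Definition pos_def_rcf (R : rcfType) (n : nat) (M : 'M[R]_n) : Prop :=
  M^T = M /\ forall v : 'cV[R]_n, v != 0 -> 0 < (v^T *m M *m v) 0 0.

Definition pos_def (A : comPzRingType) (n : nat) (M : 'M[A]_n) : Prop :=
  forall (R : rcfType) (phi : {rmorphism A -> R}), pos_def_rcf (map_mx phi M).

(* Main.v *)
(* Symmetric Gaussian elimination without division writes a multiple [s M] of a
   positive definite matrix as [L D L^T]; its pivots are positive under every
   homomorphism to a real closed field, so by the Positivstellensatz they can be
   scaled to be [1] plus a sum of squares.  The matrix [L] divides a scalar [e] of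
   the same shape, and bounding the smallest eigenvalue of [L L^T] from below gives
   a sum of squares [s] with [s M - I] again positive definite.  Eliminating once
   more, [r (s M - I) = L D L^T] with [r = 1 + t], so [r s M = I + t I + L D L^T],
   where [t I] and [L D L^T] each need at most [n p(A)] rows.

   The Positivstellensatz requires real closures of ordered fields.  Adjoining a
   root of one polynomial with a sign change is an induction on its size.  Formal
   terms that name such roots are then evaluated in all ordered extensions; the
   inequalities that hold as soon as finitely many names denote actual roots form a
   preordering of the ring of terms, and the residue field of a maximal preordering
   containing it is real closed. *)
Require Import Defs.
From HB Require Import structures.
From mathcomp Require Import all_boot all_order all_algebra.
From mathcomp Require Import boolp classical_sets.
From mathcomp Require Import ring lra zify.
Import Order.TTheory GRing.Theory Num.Theory.
Local Open Scope ring_scope.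
Local Open Scope quotient_scope.

Set Implicit Arguments. Unset Strict Implicit. Unset Printing Implicit Defensive.

(** * Preorderings and ordered residue fields *)

(** Properness [preorderingN1] also forces [B] to be nonzero: if $1 = 0$, then $-1$ is the square of
    $0$. *)
Record preordering (B : comPzRingType) (P : B -> Prop) : Prop := Preordering {
  preorderingD : forall x y, P x -> P y -> P (x + y);
  preorderingM : forall x y, P x -> P y -> P (x * y);
  preordering_sqr : forall x, P (x ^+ 2);
  preorderingN1 : ~ P (- 1)
}.

Lemma fractionP (R : idomainType) (z : {fraction R}) :
  exists n d, d != 0 /\ z = tofrac n / tofrac d.
Proof.
elim/quotW: z => -[[n d] /= d0]; exists n, d; split=> //.
unlock FracField.tofrac; rewrite -[X in _ = _ * X]FracField.pi_inv.
rewrite -[RHS]FracField.pi_mul /FracField.mulf /FracField.invf.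
rewrite !numden_Ratio ?(oner_neq0, mul1r, mulr1) //; congr \pi.
by apply: val_inj; rewrite /= /Ratio /insubd insubT.
Qed.

(** * Residue field of a prime ideal *)

Section ResidueField.
Variables (B : comNzRingType) (I : prime_idealr B).

Definition residue_domain := {ideal_quot I}.
HB.instance Definition _ := GRing.ComNzRing.copy residue_domain {ideal_quot I}.

(** Units and inverses come from choice; a non-unit is its own default inverse. *)
Let quot_unit : pred residue_domain := fun x => `[< exists y, y * x = 1 >].
Let quot_inv (x : residue_domain) :=
  if pselect (exists y, y * x = 1) is left h then sval (cid h) else x.

Fact residue_domain_mulVr : {in quot_unit, left_inverse 1 quot_inv *%R}.
Proof.
move=> x /asboolP h; rewrite /quot_inv; case: pselect => // h'.
by case: cid.
Qed.

Fact residue_domain_unitP (x y : residue_domain) : y * x = 1 -> quot_unit x.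
Proof. by move=> h; apply/asboolP; exists y. Qed.

Fact residue_domain_inv_out : {in [predC quot_unit], quot_inv =1 id}.
Proof. by move=> x /asboolP h; rewrite /quot_inv; case: pselect. Qed.

HB.instance Definition _ := GRing.ComNzRing_hasMulInverse.Build residue_domain
  residue_domain_mulVr residue_domain_unitP residue_domain_inv_out.

HB.instance Definition _ := GRing.ComUnitRing_isIntegral.Build residue_domain
  (@Quotient.rquot_IdomainAxiom B I).

Definition residue_field := {fraction residue_domain}.
HB.instance Definition _ := GRing.Field.on residue_field.

Definition residue_map (x : B) : residue_field :=
  tofrac (\pi_residue_domain x : residue_domain).

Fact residue_map_zmod : zmod_morphism residue_map.
Proof. by move=> x y; rewrite /residue_map -tofracB !piE. Qed.

Fact residue_map_monoid : monoid_morphism residue_map.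
Proof.
split; first by rewrite /residue_map -tofrac1 !piE.
by move=> x y; rewrite /residue_map -tofracM !piE.
Qed.

HB.instance Definition _ :=
  GRing.isZmodMorphism.Build B residue_field residue_map residue_map_zmod.
HB.instance Definition _ :=
  GRing.isMonoidMorphism.Build B residue_field residue_map residue_map_monoid.

Fact residue_map_eq0 x : (residue_map x == 0) = (x \in I).
Proof.
by rewrite /residue_map tofrac_eq0 piE /= Quotient.equivE subr0.
Qed.

Fact residue_map_frac (z : residue_field) :
  exists x y, residue_map y != 0 /\ z = residue_map x / residue_map y.
Proof.
have [n [d [d0 ->]]] := fractionP z.
by exists (repr n), (repr d); rewrite /residue_map !reprK tofrac_eq0.
Qed.

Lemma prime_idealr_field : exists (F : fieldType) (f : {rmorphism B -> F}),
  (forall x, (f x == 0) = (x \in I))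
  /\ forall z, exists x y, f y != 0 /\ z = f x / f y.
Proof.
exists (residue_field : fieldType), (residue_map : {rmorphism B -> residue_field}).
by split; [exact: residue_map_eq0 | exact: residue_map_frac].
Qed.

End ResidueField.

(** * The ordering given by a total cone with prime support *)

Section PrimeCone.
Variables (B : comNzRingType) (P : B -> Prop).
Hypothesis preP : preordering P.
Hypothesis totP : forall x, P x \/ P (- x).
Hypothesis primeP :
  forall x y, P (x * y) -> P (- (x * y)) -> P x /\ P (- x) \/ P y /\ P (- y).

Let PD := preorderingD preP.
Let PM := preorderingM preP.
Let Psqr := preordering_sqr preP.

Definition cone_support (x : B) : bool := `[< P x /\ P (- x) >].

Let P0 : P 0. Proof. by have := Psqr 0; rewrite expr0n. Qed.

Fact cone_support_idealr : idealr_closed cone_support.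
Proof.
split.
- by apply/asboolP; rewrite oppr0.
- by apply/asboolP => -[_]; apply: preorderingN1 preP.
move=> a x y /asboolP[Px PNx] /asboolP[Py PNy]; apply/asboolP.
(* Totality puts [a] or [- a] in [P], and the support is symmetric. *)
have [Pa|PNa] := totP a.
  by rewrite opprD -mulrN; split; apply: PD => //; apply: PM.
by rewrite opprD -mulNr -[a * x]mulrNN; split; apply: PD => //; apply: PM.
Qed.

Fact cone_support_prime : prime_idealr_closed cone_support.
Proof.
move=> x y /asboolP[Pxy PNxy]; apply/orP.
by have [h|h] := primeP Pxy PNxy; [left|right]; apply/asboolP.
Qed.

Variables (F : fieldType) (f : {rmorphism B -> F}).
Hypothesis f_eq0 : forall x, (f x == 0) = cone_support x.
Hypothesis f_frac : forall z, exists x y, f y != 0 /\ z = f x / f y.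

Fact cone_mem x y : f x = f y -> P x -> P y.
Proof.
move=> /eqP; rewrite -subr_eq0 -rmorphB f_eq0 => /asboolP[_ h] Px.
by rewrite -(subrK x y) -opprB; apply: PD.
Qed.

(** A fraction has the sign of numerator times denominator, since the two differ by the square of
    the denominator. *)
Definition cone_nonneg (z : F) : bool :=
  `[< exists x y, [/\ f y != 0, z = f x / f y & P (x * y)] >].

Fact cone_nonneg_frac x y : f y != 0 ->
  cone_nonneg (f x / f y) = `[< P (x * y) >].
Proof.
move=> y0; apply: asbool_equiv_eq; split; last by exists x, y.
move=> [x' [y' [y'0 /eqP e P']]].
rewrite eqr_div // -!rmorphM in e; move/eqP: e => e.
have : P (y' ^+ 2 * (x * y)).
  apply: (@cone_mem ((x' * y') * y ^+ 2)); last by apply: PM.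
  rewrite (_ : x' * y' * y ^+ 2 = (x' * y) * (y * y')); last by ring.
  by rewrite rmorphM -e -rmorphM; congr (f _); ring.
have [//|Pn Pp] := totP (x * y).
have /primeP : P (- (y' ^+ 2 * (x * y))) by rewrite -mulrN; apply: PM.
case=> // -[h1 h2]; last by [].
have : f (y' ^+ 2) == 0 by rewrite f_eq0; apply/asboolP.
by rewrite rmorphXn /= sqrf_eq0 (negPf y'0).
Qed.

Let cone_le (x y : F) := cone_nonneg (y - x).
Let cone_lt (x y : F) := (y != x) && cone_le x y.
Let cone_norm (x : F) := if cone_nonneg x then x else - x.

Let le0_add x y : cone_le 0 x -> cone_le 0 y -> cone_le 0 (x + y).
Proof.
rewrite /cone_le !subr0 => /asboolP[a [b [b0 -> ab]]] /asboolP[c [d [d0 -> cd]]].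
rewrite addf_div // -!rmorphM -rmorphD cone_nonneg_frac ?rmorphM ?mulf_neq0 //.
apply/asboolP; rewrite (_ : _ * _ = (a * b) * d ^+ 2 + (c * d) * b ^+ 2).
  by apply: PD; apply: PM.
by ring.
Qed.

Let le0_mul x y : cone_le 0 x -> cone_le 0 y -> cone_le 0 (x * y).
Proof.
rewrite /cone_le !subr0 => /asboolP[a [b [b0 -> ab]]] /asboolP[c [d [d0 -> cd]]].
rewrite mulf_div -!rmorphM cone_nonneg_frac ?rmorphM ?mulf_neq0 //.
by apply/asboolP; rewrite mulrACA; apply: PM.
Qed.

Let nonnegN x y : f y != 0 ->
  cone_nonneg (- (f x / f y)) = `[< P (- (x * y)) >].
Proof. by move=> y0; rewrite -mulNr -rmorphN cone_nonneg_frac // mulNr. Qed.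

Let le0_anti x : cone_le 0 x -> cone_le x 0 -> x = 0.
Proof.
rewrite /cone_le subr0 sub0r => /asboolP[a [b [b0 -> ab]]].
rewrite nonnegN // => /asboolP /(primeP ab).
have eq0 z : P z /\ P (- z) -> f z = 0.
  by move=> h; apply/eqP; rewrite f_eq0; apply/asboolP.
case=> /eq0 e; first by rewrite e mul0r.
by rewrite e eqxx in b0.
Qed.

Let sub_ge0 x y : cone_le 0 (y - x) = cone_le x y.
Proof. by rewrite /cone_le subr0. Qed.

Let le0_total x : cone_le 0 x || cone_le x 0.
Proof.
rewrite /cone_le subr0 sub0r; have [a [b [b0 ->]]] := f_frac x.
rewrite cone_nonneg_frac // nonnegN //.
by have [h|h] := totP (a * b); apply/orP; [left|right]; apply/asboolP.
Qed.

Let normN x : cone_norm (- x) = cone_norm x.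
Proof.
have := le0_total x; have := @le0_anti x.
rewrite /cone_norm /cone_le subr0 sub0r opprK.
case: ifP => hN; case: ifP => h //= anti.
by rewrite anti // oppr0.
Qed.

Let ge0_norm x : cone_le 0 x -> cone_norm x = x.
Proof. by rewrite /cone_le subr0 /cone_norm => ->. Qed.

Let lt_def x y : cone_lt x y = (y != x) && cone_le x y. Proof. by []. Qed.

Lemma ordered_fraction_field : exists (F' : realFieldType) (g : {rmorphism B -> F'}),
  (forall x, 0 <= g x <-> P x)
  /\ forall z, exists x y, g y != 0 /\ z = g x / g y.
Proof.
pose F' : realFieldType := HB.pack F (Num.IntegralDomain_isLeReal.Build F
  le0_add le0_mul le0_anti sub_ge0 le0_total normN ge0_norm lt_def).
exists F', (f : {rmorphism B -> F'}).
split=> [x|]; last exact: f_frac.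
rewrite -[_ <= _]/(cone_nonneg (f x - 0)).
rewrite subr0 -[f x]divr1 -(rmorph1 f) cone_nonneg_frac ?rmorph1 ?oner_neq0 //.
by rewrite mulr1; split=> /asboolP.
Qed.

End PrimeCone.

(** * Maximal preorderings are total with prime support *)

Section MaximalPreordering.
Variables (B : comPzRingType) (P : B -> Prop).
Hypothesis preP : preordering P.
Hypothesis maxP : forall Q, preordering Q -> (forall x, P x -> Q x) ->
  forall x, Q x -> P x.

Let PD := preorderingD preP.
Let PM := preorderingM preP.
Let Psqr := preordering_sqr preP.
Let P0 : P 0. Proof. by have := Psqr 0; rewrite expr0n. Qed.
Let P1 : P 1. Proof. by have := Psqr 1; rewrite expr1n. Qed.

(** $P + xP$ contains [P] and [x] and is closed under the operations, so by maximality it contains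
    $-1$ unless [x] is in [P]. *)
Let notinP x : ~ P x -> exists p q, [/\ P p, P q & -1 = p + x * q].
Proof.
move=> Px; apply: contrapT => noN1; apply: Px.
apply: (@maxP (fun z => exists p q, [/\ P p, P q & z = p + x * q])); first last.
- by exists 0, 1; rewrite add0r mulr1.
- by move=> y Py; exists y, 0; rewrite mulr0 addr0.
split=> //.
- move=> _ _ [p [q [Pp Pq ->]]] [p' [q' [Pp' Pq' ->]]].
  by exists (p + p'), (q + q'); split; [apply: PD|apply: PD|ring].
- move=> _ _ [p [q [Pp Pq ->]]] [p' [q' [Pp' Pq' ->]]].
  exists (p * p' + x ^+ 2 * (q * q')), (p * q' + p' * q).
  by split; last ring; apply: PD; apply: PM => //; apply: PM.
- by move=> y; exists (y ^+ 2), 0; rewrite mulr0 addr0.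
Qed.

Lemma maximal_preordering_total x : P x \/ P (- x).
Proof.
apply: contrapT => /not_orP[/notinP[p [q [Pp Pq e]]] /notinP[p' [q' [Pp' Pq' e']]]].
apply: (preorderingN1 preP).
(* The product of $-1 - p = xq$ and $-1 - p' = -xq'$ yields this expression. *)
have -> : -1 = p + p' + p * p' + x ^+ 2 * (q * q').
  have h : (x * q) * (- x * q') = (-1 - p) * (-1 - p').
    by rewrite {1}e e'; ring.
  have -> : x ^+ 2 * (q * q') = - ((x * q) * (- x * q')) by ring.
  by rewrite h; ring.
by apply: PD; [apply: PD; [apply: PD|apply: PM]|apply: PM => //; apply: PM].
Qed.

Lemma maximal_preordering_prime x y : P (x * y) -> P (- (x * y)) ->
  P x /\ P (- x) \/ P y /\ P (- y).
Proof.
(* For [u], [v] strictly positive, $uq = 1 + p$ and $vq' = 1 + p'$ multiply to a formula for $-1$ in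
   terms of $-uv$. By totality, sign changes reduce [x] and [y] to this case. *)
have key u v : P u -> P v -> ~ P (- u) -> ~ P (- v) -> ~ P (- (u * v)).
  move=> Pu Pv /notinP[p [q [Pp Pq e]]] /notinP[p' [q' [Pp' Pq' e']]] Puv.
  apply: (preorderingN1 preP).
  have -> : -1 = p + p' + p * p' + (- (u * v)) * (q * q').
    have -> : - (u * v) * (q * q') = - ((- u * q) * (- v * q')) by ring.
    have -> : - u * q = -1 - p by rewrite e; ring.
    have -> : - v * q' = -1 - p' by rewrite e'; ring.
    by ring.
  by apply: PD; [apply: PD; [apply: PD|apply: PM]|apply: PM => //; apply: PM].
move=> Pxy PNxy; apply: contrapT => /not_orP[/not_andP hx /not_andP hy].
have [Px|Px] := maximal_preordering_total x;
  have [Py|Py] := maximal_preordering_total y.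
- apply: (key x y) => //; [by case: hx|by case: hy].
- apply: (key x (- y)) => //; rewrite ?opprK ?mulrN ?opprK //;
    [by case: hx|by case: hy].
- apply: (key (- x) y) => //; rewrite ?opprK ?mulNr ?opprK //;
    [by case: hx|by case: hy].
- apply: (key (- x) (- y)) => //; rewrite ?opprK ?mulrNN ?opprK //;
    [by case: hx|by case: hy].
Qed.

End MaximalPreordering.

Lemma preordering_le_maximal (B : comPzRingType) (P : B -> Prop) : preordering P ->
  exists Q, [/\ preordering Q, forall x, P x -> Q x
    & forall Q', preordering Q' -> (forall x, Q x -> Q' x) -> forall x, Q' x -> Q x].
Proof.
move=> preP.
(* Zorn's lemma includes the empty chain, whose union is empty; joining [P] makes it a
   preordering. *)
pose S (X : set B) := preordering (fun x => X x \/ P x).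
have [F FS Ftot|A [SA maxA]] := @Zorn_bigcup B S.
  rewrite /S /=; set U := (X in preordering X).
  have U2 x y : U x -> U y ->
      P x /\ P y \/ exists2 X, F X & (X x \/ P x) /\ (X y \/ P y).
    case=> [[X FX Xx]|Px] [[Y FY Yy]|Py]; last by left.
    - right; have [XY|YX] := Ftot X Y FX FY.
        by exists Y => //; split; left => //; apply: XY.
      by exists X => //; split; left => //; apply: YX.
    - by right; exists X => //; split; [left|right].
    - by right; exists Y => //; split; [right|left].
  have inU X z : F X -> X z \/ P z -> U z.
    by move=> FX [Xz|]; [left; exists X|right].
  split.
  - move=> x y Ux Uy; have [[Px Py]|[X FX [Xx Xy]]] := U2 x y Ux Uy.
      by right; apply: (preorderingD preP).
    by apply: (inU X) => //; apply: (preorderingD (FS _ FX)).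
  - move=> x y Ux Uy; have [[Px Py]|[X FX [Xx Xy]]] := U2 x y Ux Uy.
      by right; apply: (preorderingM preP).
    by apply: (inU X) => //; apply: (preorderingM (FS _ FX)).
  - by move=> x; right; apply: preordering_sqr.
  - case=> [[X FX XN]|]; last exact: preorderingN1.
    by apply: (preorderingN1 (FS _ FX)); left.
exists (fun x => A x \/ P x); split=> // [x|Q' preQ' QQ' x Q'x]; first by right.
left; apply: contrapT => nAx; apply: (maxA Q').
  split; last by move=> h; apply: nAx; apply: h.
  by move=> z Az; apply: QQ'; left.
rewrite /S /= (_ : (fun x => _ \/ _) = Q') //; apply/funext => z.
by apply/propext; split=> [[//|Pz]|]; [apply: QQ'; right|left].
Qed.

Lemma nz_preordering_realField (B : comNzRingType) (P : B -> Prop) :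
  preordering P -> exists (F : realFieldType) (f : {rmorphism B -> F}),
    (forall x, P x -> 0 <= f x) /\ forall z, exists x y, f y != 0 /\ z = f x / f y.
Proof.
move=> /preordering_le_maximal[Q [preQ PQ maxQ]].
have totQ := maximal_preordering_total preQ maxQ.
have primeQ := maximal_preordering_prime preQ maxQ.
pose I : prime_idealr B := HB.pack (cone_support Q)
  (isIdealr.Build B _ (cone_support_idealr preQ totQ))
  (isPrimeIdealrClosed.Build B _ (cone_support_prime primeQ)).
have [F [f [f0 ff]]] := prime_idealr_field I.
have [F' [g [gQ gf]]] := ordered_fraction_field preQ totQ primeQ f0 ff.
by exists F', g; split=> // x /PQ /gQ.
Qed.

Lemma preordering_realField (B : comPzRingType) (P : B -> Prop) : preordering P ->
  exists (F : realFieldType) (f : {rmorphism B -> F}),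
    (forall x, P x -> 0 <= f x) /\ forall z, exists x y, f y != 0 /\ z = f x / f y.
Proof.
move=> preP.
have B10 : 1 != 0 :> B.
  apply/eqP => e; apply: (preorderingN1 preP).
  by rewrite e oppr0; have := preordering_sqr preP 0; rewrite expr0n.
pose B' : comNzRingType := HB.pack B (GRing.PzSemiRing_isNonZero.Build B B10).
have preP' : @preordering B' P by case: preP => ? ? ? ?; split.
have [F [f [fP ff]]] := nz_preordering_realField preP'.
have fB : zmod_morphism (f : B -> F) := rmorphB f.
have fM : monoid_morphism (f : B -> F) := conj (rmorph1 f) (rmorphM f).
pose g : {rmorphism B -> F} := HB.pack (f : B -> F)
  (GRing.isZmodMorphism.Build B F f fB) (GRing.isMonoidMorphism.Build B F f fM).
by exists F, g.
Qed.

(** * Real closures of ordered fields *)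

Definition nonneg_morph (F F' : realFieldType) (f : F -> F') :=
  forall x, 0 <= x -> 0 <= f x.

(** The least preordering of $F[X]$ containing the nonnegative constants; the weights make the
    resulting extensions respect the order of [F]. *)
Inductive weighted_sos (F : realFieldType) : {poly F} -> Prop :=
| wsos0 : weighted_sos 0
| wsosS (c : F) (f g : {poly F}) : 0 <= c -> weighted_sos g -> weighted_sos (c *: f ^+ 2 + g).

Section WeightedSos.
Variable F : realFieldType.
Implicit Types (f g h p q : {poly F}).

Lemma wsosZsqr (c : F) f : 0 <= c -> weighted_sos (c *: f ^+ 2).
Proof. by move=> c0; rewrite -[_ *: _]addr0; apply: wsosS => //; apply: wsos0. Qed.

Lemma wsosD g h : weighted_sos g -> weighted_sos h -> weighted_sos (g + h).
Proof.
move=> wg wh; elim: wg => [|c f g' c0 _ IH]; first by rewrite add0r.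
by rewrite -addrA; apply: wsosS.
Qed.

Lemma wsosM g h : weighted_sos g -> weighted_sos h -> weighted_sos (g * h).
Proof.
move=> wg wh; elim: wg => [|c f g' c0 _ IH].
  by rewrite mul0r; apply: wsos0.
rewrite mulrDl; apply: wsosD => // {IH g'}.
elim: wh => [|d e h' d0 _ IH]; first by rewrite mulr0; apply: wsos0.
rewrite mulrDr; apply: wsosD => //.
rewrite -scalerAl -scalerAr scalerA -exprMn.
by apply: wsosZsqr; apply: mulr_ge0.
Qed.

Lemma wsos_horner_ge0 (F' : realFieldType) (i : {rmorphism F -> F'}) (r : F') g :
  nonneg_morph i -> weighted_sos g -> 0 <= (map_poly i g).[r].
Proof.
move=> i0; elim=> [|c f h c0 _ IH]; first by rewrite rmorph0 horner0.
rewrite rmorphD /= map_polyZ rmorphXn /= hornerD hornerZ horner_exp.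
by rewrite addr_ge0 // mulr_ge0 ?sqr_ge0 ?i0.
Qed.

(** Each squared polynomial is reduced modulo [p]: the squares of the remainders meet the size
    bound, and [p * q] absorbs the other terms. *)
Lemma wsos_modp p g : (1 < size p)%N -> weighted_sos g ->
  exists h q, [/\ g = h + p * q, weighted_sos h & (size h <= (2 * (size p).-1).-1)%N].
Proof.
move=> p1; elim=> [|c f g' c0 _ [h [q [-> wh sh]]]].
  by exists 0, 0; rewrite mulr0 addr0 size_poly0; split=> //; apply: wsos0.
pose r : {poly F} := f %% p; pose d : {poly F} := f %/ p.
exists (c *: r ^+ 2 + h), (c *: (d ^+ 2 * p + 2 * d * r) + q); split.
- rewrite {1}(divp_eq f p) -/r -/d.
  rewrite -!mul_polyC; by ring.
- exact: wsosS.
apply: leq_trans (size_polyD _ _) _; rewrite geq_max sh andbT.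
apply: leq_trans (size_scale_leq _ _) _.
have rp : (size r < size p)%N by rewrite ltn_modp -size_poly_gt0 ltnW.
by rewrite expr2; apply: leq_trans (size_polyMleq _ _) _; lia.
Qed.

End WeightedSos.

Lemma horner_rmorph_polyC (R S : comNzRingType) (f : {rmorphism {poly R} -> S}) p :
  (map_poly (f \o polyC) p).[f 'X] = f p.
Proof. by rewrite map_poly_comp horner_map /= -[p^:P.[_]]/(p \Po 'X) comp_polyXr. Qed.

(* If [- 1 = s + p q] with [s] reduced modulo [p], then [q] has smaller size than
   [p] and changes sign where [p] does, so an extension with a root of [q] exists
   by induction; but at such a root [- 1 = s >= 0]. *)
Lemma sign_change_root_extension (F : realFieldType) (p : {poly F}) (a b : F) :
  p.[a] * p.[b] < 0 ->
  exists (F' : realFieldType) (i : {rmorphism F -> F'}) (r : F'),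
    nonneg_morph i /\ root (map_poly i p) r.
Proof.
have [n] := ubnP (size p); elim: n p => // n IH p /ltnSE szp pab.
have p1 : (1 < size p)%N.
  rewrite ltnNge; apply: contraTN pab => /size1_polyC ->.
  by rewrite !hornerC -leNgt -expr2 sqr_ge0.
pose T (z : {poly F}) := exists s q : {poly F}, weighted_sos s /\ z = s + p * q.
have [[s [q [ws e]]]|TN1] := pselect (T (- 1)).
  have [h [q' [sE wh szh]]] := wsos_modp p1 ws.
  have e' : 1 + h = p * - (q + q').
    have -> : 1 + h = 1 + (- 1 - p * (q + q')) by rewrite e sE; ring.
    by ring.
  have h_gt0 x : 0 < (1 + h).[x].
    rewrite hornerD hornerC; apply: ltr_pwDl => //.
    have := @wsos_horner_ge0 _ _ idfun x h (fun _ => id) wh.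
    by rewrite map_poly_id.
  set Q : {poly F} := - (q + q') in e'.
  have Qab : Q.[a] * Q.[b] < 0.
    have := mulr_gt0 (h_gt0 a) (h_gt0 b); rewrite e' !hornerM mulrACA.
    by rewrite nmulr_rgt0.
  have szQ : (size Q < n)%N.
    have Q0 : Q != 0.
      by apply: contraTneq Qab => ->; rewrite !horner0 mul0r ltxx.
    have p0 : p != 0 by rewrite -size_poly_gt0; lia.
    have : (size (1 + h)%R <= maxn 1 (2 * (size p).-1).-1)%N.
      apply: leq_trans (size_polyD _ _) _.
      by rewrite size_poly1 geq_max leq_maxl leq_max szh orbT.
    rewrite e' size_mul //; move: Q0 szp p1; rewrite -size_poly_gt0.
    move: (size p) (size Q) => x y; lia.
  have [F' [i [r [i0 /eqP Qr]]]] := IH Q szQ Qab.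
  have := wsos_horner_ge0 r i0 wh.
  have : (map_poly i (1 + h)).[r] = 0.
    by rewrite e' rmorphM hornerM Qr mulr0.
  rewrite rmorphD rmorph1 hornerD hornerC /=; lra.
(* Otherwise [T] is a preordering containing [p] and [- p], so the image of ['X] in its ordered
   residue field is a root of [p]. *)
have preT : preordering T.
  split=> //.
  - move=> _ _ [s [q [ws ->]]] [s' [q' [ws' ->]]]; exists (s + s'), (q + q').
    by split; [apply: wsosD|ring].
  - move=> _ _ [s [q [ws ->]]] [s' [q' [ws' ->]]].
    exists (s * s'), (s * q' + q * s' + p * q * q').
    by split; [apply: wsosM|ring].
  - move=> x; exists (x ^+ 2), 0; split; last by rewrite mulr0 addr0.
    by rewrite -[_ ^+ 2]scale1r; apply: wsosZsqr.
have [F' [f [fT _]]] := preordering_realField preT.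
exists F', (f \o polyC : {rmorphism F -> F'}), (f 'X); split.
  move=> x x0 /=; apply: fT; exists (x%:P), 0; rewrite mulr0 addr0; split=> //.
  by rewrite -[x%:P]mulr1 -(expr1n _ 2) mul_polyC; apply: wsosZsqr.
rewrite rootE horner_rmorph_polyC eq_le.
have pT : 0 <= f (0 + p * 1) by apply: fT; exists 0, 1; split=> //; apply: wsos0.
have pNT : 0 <= f (0 + p * -1) by apply: fT; exists 0, (-1); split=> //; apply: wsos0.
move: pT pNT; rewrite !add0r mulr1 mulrN1 rmorphN oppr_ge0 => -> ->.
by [].
Qed.

(** If the root [x] lies outside [[a, b]], then [a - x] and [b - x] have the same sign, so dividing
    by ['X - x%:P] keeps the sign change and lowers the size. *)
Lemma weak_ivt_real_closed (F : realFieldType) :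
  (forall (p : {poly F}) a b, p.[a] * p.[b] < 0 -> exists x, root p x) ->
  Num.real_closed_axiom F.
Proof.
move=> rootF.
have ivt n (p : {poly F}) a b : (size p < n)%N -> a <= b -> p.[a] * p.[b] < 0 ->
    exists2 x, a <= x <= b & root p x.
  elim: n p => // n IH p /ltnSE szp ab pab.
  have [x px] := rootF p a b pab.
  have [?|xab] := boolP (a <= x <= b); first by exists x.
  have [q pE] := factor_theorem p x px.
  have p0 : p != 0 by apply: contraTneq pab => ->; rewrite !horner0 mul0r ltxx.
  have q0 : q != 0 by apply: contraNneq p0 => q0; rewrite pE q0 mul0r.
  have xab_gt0 : 0 < (a - x) * (b - x).
    move: xab; rewrite negb_and -!ltNge => /orP[xa|bx].
      by apply: mulr_gt0; lra.
    by rewrite -mulrNN; apply: mulr_gt0; lra.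
  have qab : q.[a] * q.[b] < 0.
    move: pab; rewrite pE !hornerM !hornerXsubC mulrACA.
    by rewrite pmulr_llt0.
  have szq : (size q < n)%N.
    by move: szp; rewrite pE size_mul ?polyXsubC_eq0 // size_XsubC addn2.
  have [y yab qy] := IH q szq ab qab.
  by exists y => //; rewrite pE rootM qy.
move=> p a b ab /andP[pa pb].
have [pa0|pa0] := eqVneq p.[a] 0; first by exists a; rewrite ?lexx ?ab //; apply/eqP.
have [pb0|pb0] := eqVneq p.[b] 0; first by exists b; rewrite ?lexx ?ab //; apply/eqP.
apply: (ivt (size p).+1) => //.
by rewrite nmulr_rlt0 lt_neqAle ?pa ?pa0 // eq_sym pb0 pb.
Qed.

(* [TRoot c a b] names a root of the polynomial with coefficient list [c],
   provided that polynomial changes sign between [a] and [b]. *)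
Inductive term (K : Type) : Type :=
| TConst of K
| TAdd of term K & term K
| TMul of term K & term K
| TOpp of term K
| TInv of term K
| TRoot of seq (term K) & term K & term K.

HB.instance Definition _ K := gen_eqMixin (term K).
HB.instance Definition _ K := gen_choiceMixin (term K).

(** * Models of the terms and the ring of terms *)

Section Terms.
Variable K : realFieldType.
Implicit Types (s t u v : term K) (c : seq (term K)).

(* Counts only nested [TRoot]s: evaluating [TRoot c a b] looks up its value and
   does not evaluate [c], [a], [b]. *)
Fixpoint root_depth t : nat :=
  match t with
  | TConst _ => 0
  | TAdd s t | TMul s t => maxn (root_depth s) (root_depth t)
  | TOpp t | TInv t => root_depth t
  | TRoot c a b =>
    (maxn (\max_(d <- map root_depth c) d) (maxn (root_depth a) (root_depth b))).+1
  end.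

(** An ordered extension of [K] with a table of values for names. Correctness of an entry is left to
    [good], so that it can be imposed on finitely many names at a time. *)
Record model := Model {
  model_field :> realFieldType;
  model_morph : {rmorphism K -> model_field};
  model_nonneg : nonneg_morph model_morph;
  model_root : term K -> model_field
}.
Implicit Type M : model.

Fixpoint eval M t : M :=
  match t with
  | TConst x => model_morph M x
  | TAdd s t => eval M s + eval M t
  | TMul s t => eval M s * eval M t
  | TOpp t => - eval M t
  | TInv t => (eval M t)^-1
  | TRoot _ _ _ => model_root M t
  end.

Definition thorner c t : term K :=
  foldr (fun u v => TAdd (TMul v t) u) (TConst 0) c.

(* [0 <= p(a) p(b) p(r)^2] says that [r] is a root of [p] if [p(a) p(b) < 0]. *)
Definition root_axiom t : term K :=
  if t is TRoot c a b then
    TMul (TMul (thorner c a) (thorner c b)) (TMul (thorner c t) (thorner c t))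
  else TConst 0.

Definition good M t := 0 <= eval M (root_axiom t).

Lemma eval_thorner M c t : eval M (thorner c t) = (Poly (map (eval M) c)).[eval M t].
Proof.
rewrite horner_Poly; elim: c => [|u c IH] /=; first exact: rmorph0.
by rewrite IH.
Qed.

Lemma good_rootE M c a b :
  good M (TRoot c a b) =
  (0 <= (Poly (map (eval M) c)).[eval M a] * (Poly (map (eval M) c)).[eval M b]
        * (Poly (map (eval M) c)).[eval M (TRoot c a b)] ^+ 2).
Proof. by rewrite /good /= !eval_thorner. Qed.

Section ExtendModel.
Variables (M : model) (c : seq (term K)) (a b : term K).
Let r := TRoot c a b.
Variables (F : realFieldType) (i : {rmorphism M -> F}) (x : F).
Hypotheses (i_nonneg : nonneg_morph i)
  (ix : root (map_poly i (Poly (map (eval M) c))) x).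

Let j : {rmorphism K -> F} := i \o model_morph M.
Let j_nonneg : nonneg_morph j.
Proof. by move=> y y0; apply/i_nonneg/model_nonneg. Qed.

Definition extend_model : model :=
  Model j_nonneg (fun t => if t == r then x else i (model_root M t)).
Local Notation M' := extend_model.

(** A term of smaller depth never looks up [r], the one entry given a new value. *)
Lemma eval_extend t : (root_depth t < root_depth r)%N -> eval M' t = i (eval M t).
Proof.
elim: t => [y|s IHs t IHt|s IHs t IHt|t IHt|t IHt|c' a' _ b' _] //.
- by rewrite [root_depth _]/= gtn_max => /andP[hs ht] /=; rewrite rmorphD IHs ?IHt.
- by rewrite [root_depth _]/= gtn_max => /andP[hs ht] /=; rewrite rmorphM IHs ?IHt.
- by move=> h /=; rewrite rmorphN IHt.
- by move=> h /=; rewrite fmorphV IHt.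
by move=> h /=; case: eqP => // e; move: h; rewrite e ltnn.
Qed.

Lemma root_depth_args c' a' b' (d := root_depth (TRoot c' a' b')) :
  [/\ forall t, t \in c' -> (root_depth t < d)%N,
      (root_depth a' < d)%N & (root_depth b' < d)%N].
Proof.
rewrite /d /= !ltnS; split=> [t tc||]; rewrite ?ltnS !leq_max ?leqnn ?orbT //.
by rewrite (@leq_bigmax_seq _ _ xpredT id _ (map_f root_depth tc)).
Qed.

Lemma eval_extend_args c' a' b' : (root_depth (TRoot c' a' b') <= root_depth r)%N ->
  [/\ Poly (map (eval M') c') = map_poly i (Poly (map (eval M) c')),
      eval M' a' = i (eval M a') & eval M' b' = i (eval M b')].
Proof.
move=> le_r; have [hc ha hb] := root_depth_args c' a' b'.
split; try by apply: eval_extend; apply: leq_trans le_r.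
rewrite map_Poly -map_comp; congr Poly; apply/eq_in_map => t tc.
by apply: eval_extend; apply: leq_trans le_r; apply: hc.
Qed.

Lemma good_extend_root : good M' r.
Proof.
rewrite good_rootE; have [-> _ _] := eval_extend_args (leqnn (root_depth r)).
by rewrite [eval M' r]/= eqxx (eqP ix) expr0n mulr0.
Qed.

Lemma good_extend t : t != r -> (root_depth t <= root_depth r)%N ->
  good M t -> good M' t.
Proof.
case: t => [y|? ?|? ?|?|?|c' a' b'] tr le_r; try by rewrite /good /= !rmorph0.
rewrite !good_rootE; have [-> -> ->] := eval_extend_args le_r.
rewrite [eval M' (TRoot _ _ _)]/= (negPf tr) !horner_map -rmorphXn -!rmorphM.
exact: i_nonneg.
Qed.

End ExtendModel.

(** With the deepest names first, induction adds the head last. If its entry is not good, its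
    polynomial changes sign; adjoining a root repairs it and keeps good the other names, which are
    at most as deep. *)
Lemma exists_good_model (l : seq (term K)) : exists M, forall t, t \in l -> good M t.
Proof.
pose R := relpre root_depth geq.
suff main (s : seq (term K)) : sorted R s -> exists M, forall t, t \in s -> good M t.
  have [|M goodM] := main (sort R l).
    by apply: sort_sorted => x y; apply: leq_total.
  by exists M => t tl; apply: goodM; rewrite mem_sort.
elim: s => [_|r s IH].
  by exists (@Model K idfun (fun _ => id) (fun _ => 0)).
rewrite /= path_sortedE; last by move=> x y z /= yx xz; apply: leq_trans xz yx.
case/andP=> /allP le_r /IH[M goodM].
have [gr|ngr] := boolP (good M r).
  by exists M => t; rewrite inE => /predU1P[->|/goodM].
have neq_r t : t \in s -> t != r.
  by move=> ts; apply: contraNneq ngr => <-; apply: goodM.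
case: r ngr le_r neq_r => [y|? ?|? ?|?|?|c a b] ngr le_r neq_r;
  try by rewrite /good /= rmorph0 lexx in ngr.
move: ngr; rewrite good_rootE -ltNge => ngr.
have pab : (Poly (map (eval M) c)).[eval M a] * (Poly (map (eval M) c)).[eval M b] < 0.
  by rewrite ltNge; apply: contraTN ngr => h; rewrite -leNgt mulr_ge0 ?sqr_ge0.
have [F [i [x [i0 ix]]]] := sign_change_root_extension pab.
exists (extend_model c a b x i0) => t; rewrite inE => /predU1P[->|ts].
  exact: good_extend_root.
by apply: good_extend; [exact: neq_r|exact: le_r|exact: goodM].
Qed.

(** The quotient behaves like a subring of the product of all models, so ring identities are checked
    model by model. *)
Definition term_equiv s t : bool := `[< forall M, eval M s = eval M t >].

Fact term_equiv_is_equiv : equiv_class_of term_equiv.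
Proof.
split=> [s|s t|t s u].
- by apply/asboolP.
- by apply/asboolP/asboolP => h M; rewrite h.
- by move=> /asboolP h /asboolP h'; apply/asboolP => M; rewrite h h'.
Qed.

Canonical term_equiv_equiv := EquivRelPack term_equiv_is_equiv.
Canonical term_equiv_encModRel := defaultEncModRel term_equiv.

Definition term_ring := {eq_quot term_equiv}.
HB.instance Definition _ := EqQuotient.on term_ring.
HB.instance Definition _ := Choice.on term_ring.

Definition teval M (x : term_ring) : M := eval M (repr x).

Lemma teval_pi M t : teval M (\pi t) = eval M t.
Proof. by rewrite /teval; case: piP => s /eqmodP/asboolP ->. Qed.

Lemma teval_inj (x y : term_ring) : (forall M, teval M x = teval M y) -> x = y.
Proof.
by move=> h; rewrite -[x]reprK -[y]reprK; apply/eqmodP/asboolP.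
Qed.

Let tconst (k : K) : term_ring := \pi_term_ring (TConst k).
Let tadd (x y : term_ring) : term_ring := \pi_term_ring (TAdd (repr x) (repr y)).
Let tmul (x y : term_ring) : term_ring := \pi_term_ring (TMul (repr x) (repr y)).
Let topp (x : term_ring) : term_ring := \pi_term_ring (TOpp (repr x)).

Let tE M : (forall k, teval M (tconst k) = model_morph M k)
  * (forall x y, teval M (tadd x y) = teval M x + teval M y)
  * (forall x y, teval M (tmul x y) = teval M x * teval M y)
  * (forall x, teval M (topp x) = - teval M x).
Proof. by do !split=> *; rewrite teval_pi. Qed.

Fact taddA : associative tadd.
Proof. by move=> x y z; apply: teval_inj => M; rewrite !tE addrA. Qed.
Fact taddC : commutative tadd.
Proof. by move=> x y; apply: teval_inj => M; rewrite !tE addrC. Qed.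
Fact tadd0 : left_id (tconst 0) tadd.
Proof. by move=> x; apply: teval_inj => M; rewrite !tE rmorph0 add0r. Qed.
Fact taddN : left_inverse (tconst 0) topp tadd.
Proof. by move=> x; apply: teval_inj => M; rewrite !tE rmorph0 addNr. Qed.
HB.instance Definition _ := GRing.isZmodule.Build term_ring taddA taddC tadd0 taddN.

Fact tmulA : associative tmul.
Proof. by move=> x y z; apply: teval_inj => M; rewrite !tE mulrA. Qed.
Fact tmulC : commutative tmul.
Proof. by move=> x y; apply: teval_inj => M; rewrite !tE mulrC. Qed.
Fact tmul1 : left_id (tconst 1) tmul.
Proof. by move=> x; apply: teval_inj => M; rewrite !tE rmorph1 mul1r. Qed.
Fact tmulDl : left_distributive tmul tadd.
Proof. by move=> x y z; apply: teval_inj => M; rewrite !tE mulrDl. Qed.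
HB.instance Definition _ :=
  GRing.Zmodule_isComPzRing.Build term_ring tmulA tmulC tmul1 tmulDl.

Lemma teval_zmod M : zmod_morphism (teval M).
Proof. by move=> x y; rewrite -[x - y]/(tadd x (topp y)) !tE. Qed.
Lemma teval_monoid M : monoid_morphism (teval M).
Proof.
split; first by rewrite -[1]/(tconst 1) tE rmorph1.
by move=> x y; rewrite -[x * y]/(tmul x y) tE.
Qed.
HB.instance Definition _ M :=
  GRing.isZmodMorphism.Build term_ring M (teval M) (teval_zmod M).
HB.instance Definition _ M :=
  GRing.isMonoidMorphism.Build term_ring M (teval M) (teval_monoid M).

Definition eventually_nonneg (x : term_ring) :=
  exists l : seq (term K),
    forall M, (forall t, t \in l -> good M t) -> 0 <= teval M x.

(** Lists are concatenated for sums and products; being finite, they always admit a good model,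
    which excludes $-1$. *)
Lemma eventually_nonneg_preordering : preordering eventually_nonneg.
Proof.
split.
- move=> x y [l hl] [l' hl']; exists (l ++ l') => M goodM; rewrite rmorphD.
  by rewrite addr_ge0 ?hl ?hl' // => t tl; apply: goodM; rewrite mem_cat tl ?orbT.
- move=> x y [l hl] [l' hl']; exists (l ++ l') => M goodM; rewrite rmorphM.
  by rewrite mulr_ge0 ?hl ?hl' // => t tl; apply: goodM; rewrite mem_cat tl ?orbT.
- by move=> x; exists [::] => M _; rewrite rmorphXn sqr_ge0.
- case=> l hl; have [M /hl] := exists_good_model l.
  by rewrite rmorphN1 ler0N1.
Qed.

End Terms.

(** Every element of the residue field [F] is the value [g t] of a term. Hence coefficients and
    endpoints of a sign change are named by terms, and [TRoot] names a root. *)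
Theorem real_closure_exists (K : realFieldType) :
  exists (R : rcfType) (f : {rmorphism K -> R}), nonneg_morph f.
Proof.
have [F [f [fP ffrac]]] := preordering_realField (@eventually_nonneg_preordering K).
pose g (t : term K) : F := f (\pi_(term_ring K) t).
have g_morph (x : term_ring K) t : (forall M : model K, teval M x = eval M t) -> f x = g t.
  by move=> h; congr (f _); apply: teval_inj => M; rewrite h teval_pi.
have gD s t : g (TAdd s t) = g s + g t.
  by rewrite -rmorphD; symmetry; apply: g_morph => M; rewrite rmorphD /= !teval_pi.
have gM s t : g (TMul s t) = g s * g t.
  by rewrite -rmorphM; symmetry; apply: g_morph => M; rewrite rmorphM /= !teval_pi.
have gN t : g (TOpp t) = - g t.
  by rewrite -rmorphN; symmetry; apply: g_morph => M; rewrite rmorphN /= !teval_pi.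
have g1 : g (TConst 1) = 1.
  rewrite -(rmorph1 f); symmetry; apply: g_morph => M.
  by rewrite rmorph1 /= rmorph1.
have gV t : g t != 0 -> g (TInv t) = (g t)^-1.
  (* The identity $t(t t^{-1}) = t$ holds in every model, even where $t = 0$. *)
  move=> t0; apply: (mulfI t0); apply: (mulfI t0); rewrite mulfV // mulr1 -!gM.
  symmetry; apply: g_morph => M; rewrite teval_pi /=.
  by have [->|h] := eqVneq (eval M t) 0; rewrite ?mul0r // mulfV // mulr1.
have g_surj z : exists t, z = g t.
  have [x [y [y0 ->]]] := ffrac z; exists (TMul (repr x) (TInv (repr y))).
  have gr u : g (repr u) = f u by rewrite /g reprK.
  by rewrite gM gV ?gr.
have gc_zmod : zmod_morphism (g \o @TConst K).
  move=> x y; rewrite /= -gN -gD; symmetry; rewrite [LHS]/g; apply: g_morph => M.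
  by rewrite teval_pi /= rmorphB.
have gc_monoid : monoid_morphism (g \o @TConst K).
  split=> [|x y]; first exact: g1.
  rewrite /= -gM; symmetry; rewrite [LHS]/g; apply: g_morph => M.
  by rewrite teval_pi /= rmorphM.
have g_horner c t : g (thorner c t) = (Poly (map g c)).[g t].
  rewrite horner_Poly; elim: c => [|u c IH] /=; last by rewrite gD gM IH.
  by have := gc_zmod 0 0; rewrite /= !subrr.
have ivtF (p : {poly F}) a b : p.[a] * p.[b] < 0 -> exists x, root p x.
  have [[c pc] [[s ->] [t ->]]] : (exists c, map g c = p) /\
      (exists s, a = g s) /\ exists t, b = g t.
    split=> //; elim: (polyseq p) => [|x l [c <-]]; first by exists [::].
    by have [u ->] := g_surj x; exists (u :: c).
  have {pc} <- : Poly (map g c) = p by rewrite pc polyseqK.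
  (* If this value were not a root, the root axiom would be negative in [F], although it is
     eventually nonnegative. *)
  move=> pst; exists (g (TRoot c s t)); apply: contraTT isT; rewrite rootE => pr.
  have /fP : eventually_nonneg (\pi_(term_ring K) (root_axiom (TRoot c s t))).
    exists [:: TRoot c s t] => M goodM; rewrite teval_pi; apply: goodM.
    by rewrite mem_head.
  rewrite -[f _]/(g _) /= !gM !g_horner leNgt nmulr_rlt0 //.
  by rewrite -expr2 exprn_even_gt0 //= pr.
pose R : rcfType := HB.pack F
  (Num.RealField_isClosed.Build F (weak_ivt_real_closed ivtF)).
pose h : {rmorphism K -> F} := HB.pack (g \o @TConst K)
  (GRing.isZmodMorphism.Build K F _ gc_zmod)
  (GRing.isMonoidMorphism.Build K F _ gc_monoid).
exists R, (h : {rmorphism K -> R}) => x x0; apply: fP.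
by exists [::] => M _; rewrite teval_pi; apply: model_nonneg.
Qed.

(** * Positivstellensatz *)

Section SumOfSquares.
Variable A : comPzRingType.
Implicit Types s t x : A.

Lemma sos_sqr x : sum_of_squares (x ^+ 2).
Proof. by exists [:: x]; rewrite big_seq1. Qed.

Lemma sos0 : sum_of_squares (0 : A).
Proof. by exists [::]; rewrite big_nil. Qed.

Lemma sos1 : sum_of_squares (1 : A).
Proof. by rewrite -(expr1n _ 2); apply: sos_sqr. Qed.

Lemma sosD s t : sum_of_squares s -> sum_of_squares t -> sum_of_squares (s + t).
Proof. by move=> [l ->] [l' ->]; exists (l ++ l'); rewrite big_cat. Qed.

Lemma sosM s t : sum_of_squares s -> sum_of_squares t -> sum_of_squares (s * t).
Proof.
move=> [l ->] [l' ->]; elim: l => [|x l IH].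
  by rewrite big_nil mul0r; apply: sos0.
rewrite big_cons mulrDl; apply: sosD => //; exists (map ( *%R x) l').
by rewrite big_map mulr_sumr; apply: eq_bigr => y _; rewrite exprMn.
Qed.

Lemma sos_sum (I : Type) (r : seq I) (f : I -> A) :
  (forall i, sum_of_squares (f i)) -> sum_of_squares (\sum_(i <- r) f i).
Proof. by move=> h; elim/big_ind: _ => //; [apply: sos0|apply: sosD]. Qed.

Lemma sos_sum_of_q_squares s : sum_of_squares s -> exists q, sum_of_q_squares q s.
Proof.
case=> l ->; exists (size l), (fun i : 'I_(size l) => l`_i).
by rewrite (big_nth 0) big_mkord.
Qed.

(** Closed under products and at least $1$ under every homomorphism to an ordered domain, these
    elements are the scaling factors that replace division. *)
Definition unit_sos s := exists2 t, sum_of_squares t & s = 1 + t.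

Lemma unit_sosW s : unit_sos s -> sum_of_squares s.
Proof. by case=> t ht ->; apply: sosD => //; apply: sos1. Qed.

Lemma unit_sos1 : unit_sos 1.
Proof. by exists 0; [apply: sos0|rewrite addr0]. Qed.

Lemma unit_sosM s t : unit_sos s -> unit_sos t -> unit_sos (s * t).
Proof.
move=> [s' hs ->] [t' ht ->]; exists (s' + t' + s' * t'); last by ring.
by apply: sosD; [apply: sosD|apply: sosM].
Qed.

Lemma unit_sos_ge1 (R : realDomainType) (phi : {rmorphism A -> R}) s :
  unit_sos s -> 1 <= phi s.
Proof.
case=> _ [l ->] ->; rewrite rmorphD rmorph1 lerDl rmorph_sum.
by apply: sumr_ge0 => x _; rewrite rmorphXn sqr_ge0.
Qed.

(** If no [s] exists, the elements $p - xq$ with [p], [q] sums of squares form a preordering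
    containing $-x$. In the real closure of its ordered residue field, [x] is not positive. *)
Lemma positivstellensatz x :
  (forall (R : rcfType) (phi : {rmorphism A -> R}), 0 < phi x) ->
  exists2 s, sum_of_squares s & unit_sos (s * x).
Proof.
move=> x_gt0; apply: contrapT => noS.
pose T z := exists p q, [/\ sum_of_squares p, sum_of_squares q & z = p - x * q].
have preT : preordering T.
  split.
  - move=> _ _ [p [q [hp hq ->]]] [p' [q' [hp' hq' ->]]].
    exists (p + p'), (q + q').
    by split; [apply: sosD|apply: sosD|ring].
  - move=> _ _ [p [q [hp hq ->]]] [p' [q' [hp' hq' ->]]].
    exists (p * p' + x ^+ 2 * (q * q')), (p * q' + q * p'); split; last by ring.
      by apply: sosD; apply: sosM => //; [apply: sos_sqr|apply: sosM].
    by apply: sosD; apply: sosM.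
  - move=> z; exists (z ^+ 2), 0; rewrite mulr0 subr0.
    by split=> //; [apply: sos_sqr|apply: sos0].
  case=> p [q [hp hq e]]; apply: noS; exists q => //; exists p => //.
  have -> : q * x = p - (p - x * q) by ring.
  by rewrite -e; ring.
have [F [f [fT _]]] := preordering_realField preT.
have [R [g g0]] := real_closure_exists F.
have := x_gt0 R (g \o f : {rmorphism A -> R}); rewrite /= ltNge -oppr_ge0 -!rmorphN.
case/negP; apply/g0/fT; exists 0, 1; rewrite sub0r mulr1.
by split=> //; [apply: sos0|apply: sos1].
Qed.

(* From [s x = 1 + t], [s (1 + x^2) = s (1 - x)^2 + 2 s x] also exceeds [1]. *)
Lemma unit_positivstellensatz x :
  (forall (R : rcfType) (phi : {rmorphism A -> R}), 0 < phi x) ->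
  exists2 s, unit_sos s & unit_sos (s * x).
Proof.
move=> /positivstellensatz[s hs [t ht sx]]; exists (s * (1 + x ^+ 2)).
  exists (s * (1 - x) ^+ 2 + (1 + t + t)).
    apply: sosD; first by apply: sosM => //; apply: sos_sqr.
    by apply: sosD => //; apply: sosD => //; apply: sos1.
  have -> : s * (1 + x ^+ 2) = s * (1 - x) ^+ 2 + s * x + s * x by ring.
  by rewrite sx; ring.
rewrite mulrAC sx; apply: unit_sosM; first by exists t.
by exists (x ^+ 2); first exact: sos_sqr.
Qed.

End SumOfSquares.

(** * Positive definite matrices *)

Lemma pos_def_ulcorner (A : comPzRingType) n (M : 'M[A]_(1 + n)) :
  pos_def M -> forall (R : rcfType) (phi : {rmorphism A -> R}), 0 < phi (M 0 0).
Proof.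
move=> pM R phi; have [_ /(_ (delta_mx 0 0))] := pM R phi.
rewrite trmx_delta -rowE -colE !mxE; apply.
by apply/eqP => /matrixP/(_ 0 0)/eqP; rewrite !mxE eqxx oner_eq0.
Qed.

(** The usual Schur complement multiplied by the corner [M 0 0], which clears the denominator. *)
Definition schur_compl (A : comPzRingType) n (M : 'M[A]_(1 + n)) : 'M[A]_n :=
  M 0 0 *: drsubmx M - dlsubmx M *m (dlsubmx M)^T.

Lemma symmetric_block (A : comPzRingType) n (M : 'M[A]_(1 + n)) : symmetric_mx M ->
  M = block_mx (M 0 0)%:M (dlsubmx M)^T (dlsubmx M) (drsubmx M).
Proof.
move=> sM; rewrite -[LHS]submxK; congr block_mx.
  by rewrite [LHS]mx11_scalar !mxE; congr (M _ _)%:M; apply: val_inj.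
by rewrite trmx_dlsub sM.
Qed.

Lemma symmetric_schur_compl (A : comPzRingType) n (M : 'M[A]_(1 + n)) :
  symmetric_mx M -> symmetric_mx (schur_compl M).
Proof.
move=> sM; rewrite /symmetric_mx /schur_compl linearB /= linearZ /= trmx_mul trmxK.
by rewrite trmx_drsub sM.
Qed.

(** With corner $a > 0$ and column $b$ below it, the form of $M$ at $(-b^t y, a y)$ equals $a\,y^t S
    y$, where $S$ is the Schur complement. *)
Lemma pos_def_schur_compl (A : comPzRingType) n (M : 'M[A]_(1 + n)) :
  symmetric_mx M -> pos_def M -> pos_def (schur_compl M).
Proof.
move=> sM pM R phi; split.
  by rewrite map_trmx symmetric_schur_compl.
move=> y y0; have a0 := pos_def_ulcorner pM phi.
set a := phi _ in a0; pose b := map_mx phi (dlsubmx M).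
pose M' := map_mx phi (drsubmx M).
have ME : map_mx phi M = block_mx a%:M b^T b M'.
  by rewrite {1}(symmetric_block sM) map_block_mx map_scalar_mx -map_trmx.
have -> : map_mx phi (schur_compl M) = a *: M' - b *m b^T.
  by rewrite map_mxB map_mxZ map_mxM -map_trmx.
have [_ /(_ (col_mx (- (b^T *m y)) (a *: y)))] := pM R phi.
rewrite ME -mulmxA mul_block_col tr_col_mx mul_row_col.
have -> : a%:M *m - (b^T *m y) + b^T *m (a *: y) = 0.
  by rewrite mul_scalar_mx scalerN -scalemxAr addNr.
have -> : b *m - (b^T *m y) + M' *m (a *: y) = (a *: M' - b *m b^T) *m y.
  by rewrite mulmxBl mulmxN -scalemxAr -scalemxAl mulmxA addrC.
rewrite mulmx0 add0r linearZ /= -scalemxAl mxE pmulr_rgt0 // mulmxA; apply.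
apply: contraNneq y0 => /eqP; rewrite col_mx_eq0 scaler_eq0 (gt_eqF a0).
by case/andP.
Qed.

(** The equation [L *m T = e%:M] stands in for invertibility of [L]. *)
Definition LDL_form (A : comPzRingType) n (M : 'M[A]_n) :=
  exists (s e : A) (d : 'rV[A]_n) (L T : 'M[A]_n),
    [/\ unit_sos s, unit_sos e, forall i, unit_sos (d 0 i),
        s *: M = L *m diag_mx d *m L^T & L *m T = e%:M].

(* Symmetric Gaussian elimination without division by [a = M 0 0]:
   [a^2 M = L diag(a, a S) L^T] with [L = (a 0; b 1)] and [S] the Schur complement. *)
Lemma LDL_form_schur (A : comPzRingType) n (M : 'M[A]_(1 + n)) (s : A) :
  symmetric_mx M -> unit_sos s -> unit_sos (s * M 0 0) ->
  LDL_form (schur_compl M) -> LDL_form M.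
Proof.
move=> sM us usa [s' [e [d [L [T [us' ue ud SE LT]]]]]].
pose a := M 0 0; pose b := dlsubmx M.
have [u uu uE] : exists2 u, unit_sos u & u = s * a by exists (s * a).
(* Multiplying the identity for $a^2 M$ by $s^2 s'$ turns the pivots into $s s' u$ and $s u d$, all
   of them $1$ plus a sum of squares. *)
exists (u ^+ 2 * s'), (u * e), (row_mx (s * s' * u)%:M ((s * u) *: d)).
exists (block_mx a%:M 0 b L), (s *: block_mx e%:M 0 (- (T *m b)) (a *: T)).
split.
- by rewrite expr2; do !apply: unit_sosM.
- exact: unit_sosM.
- move=> i; rewrite mxE; case: split_ordP => j _; rewrite !mxE.
    by rewrite ord1 eqxx mulr1n; do !apply: unit_sosM.
  by do !apply: unit_sosM.
- rewrite {1}(symmetric_block sM) -/a -/b diag_mx_row tr_block_mx.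
  rewrite !mulmx_block !(mulmx0, mul0mx, addr0, add0r, trmx0).
  rewrite scale_block_mx linearZ /= -scalemxAr -scalemxAl -SE.
  have -> : diag_mx (s * s' * u)%:M = (s * s' * u)%:M :> 'M[A]_1.
    by apply/matrixP => i j; rewrite !mxE !ord1.
  rewrite !tr_scalar_mx !mul_mx_scalar -!scalemxAl !mul_scalar_mx !scalerA.
  rewrite !scale_scalar_mx /schur_compl -/a -/b scalerBr !scalerA.
  congr block_mx.
  + by congr _%:M; rewrite uE; ring.
  + by congr (_ *: _); rewrite uE; ring.
  + by congr (_ *: _); rewrite uE; ring.
  rewrite addrCA -scalerBl.
  rewrite (_ : _ - _ = 0) ?scale0r ?addr0; last by ring.
  by congr (_ *: _); rewrite uE; ring.
rewrite -scalemxAr mulmx_block !(mulmx0, mul0mx, addr0, add0r).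
rewrite mulmxN mulmxA -scalemxAr LT !mul_mx_scalar !mul_scalar_mx.
rewrite !scale_scalar_mx subrr (mulrC e a) -scalar_mx_block scale_scalar_mx.
by congr _%:M; rewrite uE; ring.
Qed.

Lemma pos_def_LDL (A : comPzRingType) n (M : 'M[A]_n) :
  symmetric_mx M -> pos_def M -> LDL_form M.
Proof.
elim: n M => [|n IH] M sM pM.
  exists 1, 1, 0, 1%:M, 1%:M; split; try exact: unit_sos1; first by case.
    by rewrite [LHS]flatmx0 [RHS]flatmx0.
  by rewrite [LHS]flatmx0 [RHS]flatmx0.
have [s us usa] := unit_positivstellensatz (pos_def_ulcorner pM).
apply: (LDL_form_schur (n := n) sM us usa).
exact: IH (symmetric_schur_compl sM) (pos_def_schur_compl sM pM).
Qed.

(** * Norm estimates and Gram matrices *)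

(** Lagrange's identity: the squares of all $x_i y_j - x_j y_i$ add up to twice the difference of
    the two sides. *)
Lemma CauchySchwarz_sum (R : realDomainType) (I : finType) (x y : I -> R) :
  (\sum_i x i * y i) ^+ 2 <= (\sum_i x i ^+ 2) * (\sum_i y i ^+ 2).
Proof.
pose f i j := x i * y j - x j * y i.
have : 0 <= \sum_i \sum_j f i j ^+ 2.
  by do 2![apply: sumr_ge0 => ? _]; apply: sqr_ge0.
have -> : \sum_i \sum_j f i j ^+ 2 =
    ((\sum_i x i ^+ 2) * (\sum_i y i ^+ 2) - (\sum_i x i * y i) ^+ 2) *+ 2.
  rewrite mulr2n expr2 {2}(mulrC (\sum_i x i ^+ 2)) !big_distrlr /=.
  rewrite addrACA -opprD -!big_split -sumrB /=; apply: eq_bigr => i _.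
  rewrite -!big_split -sumrB /=; apply: eq_bigr => j _.
  by rewrite /f; ring.
by rewrite pmulrn_lge0 // subr_ge0.
Qed.

Section Norms.
Variable R : realDomainType.

Definition sqnorm n (v : 'cV[R]_n) : R := \sum_i v i 0 ^+ 2.

Lemma sqnormE n (v : 'cV[R]_n) : (v^T *m v) 0 0 = sqnorm v.
Proof. by rewrite mxE; apply: eq_bigr => i _; rewrite mxE. Qed.

Lemma sqnorm_ge0 n (v : 'cV[R]_n) : 0 <= sqnorm v.
Proof. by apply: sumr_ge0 => i _; apply: sqr_ge0. Qed.

Lemma sqnorm_gt0 n (v : 'cV[R]_n) : v != 0 -> 0 < sqnorm v.
Proof.
move=> v0; rewrite lt_def sqnorm_ge0 andbT; apply: contraNneq v0.
move=> /psumr_eq0P h; apply/eqP/matrixP => i j; rewrite ord1 mxE.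
by apply/eqP; rewrite -sqrf_eq0 h // => k _; apply: sqr_ge0.
Qed.

Lemma sqnormZ n a (v : 'cV[R]_n) : sqnorm (a *: v) = a ^+ 2 * sqnorm v.
Proof. by rewrite mulr_sumr; apply: eq_bigr => i _; rewrite mxE exprMn. Qed.

(** Cauchy-Schwarz in each coordinate; the factor is the squared Frobenius norm of [T]. *)
Lemma sqnorm_mulmx_le n (T : 'M[R]_n) (w : 'cV[R]_n) :
  sqnorm (T^T *m w) <= (\sum_i \sum_j T i j ^+ 2) * sqnorm w.
Proof.
rewrite exchange_big mulr_suml; apply: ler_sum => j _.
rewrite mxE (eq_bigr (fun i => T i j * w i 0)) ?CauchySchwarz_sum // => i _.
by rewrite mxE.
Qed.

Lemma sqnorm_le_diag n (d : 'rV[R]_n) (w : 'cV[R]_n) : (forall i, 1 <= d 0 i) ->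
  sqnorm w <= (w^T *m diag_mx d *m w) 0 0.
Proof.
move=> d1; rewrite -mulmxA mxE; apply: ler_sum => i _.
rewrite mul_diag_mx !mxE mulrCA -expr2.
by rewrite ler_peMl ?sqr_ge0.
Qed.

End Norms.

(* [L T = e I] bounds the smallest eigenvalue of [L L^T] from below by
   [e^2 / |T|^2], so [2 |T|^2 s M >= 2 I]. *)
Lemma pos_def_sub1 (A : comPzRingType) n (M : 'M[A]_n) :
  symmetric_mx M -> pos_def M -> exists s : A,
    [/\ sum_of_squares s, symmetric_mx (s *: M - 1%:M) & pos_def (s *: M - 1%:M)].
Proof.
move=> sM pM; have [s [e [d [L [T [us ue ud sME LT]]]]]] := pos_def_LDL sM pM.
pose c := \sum_i \sum_j T i j ^+ 2.
have sN : symmetric_mx ((2 * c * s) *: M - 1%:M).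
  by rewrite /symmetric_mx linearB /= linearZ /= sM tr_scalar_mx.
exists (2 * c * s); split=> //.
  apply: sosM; last exact: unit_sosW.
  apply: sosM; first by apply: (@sosD _ 1 1); apply: sos1.
  by do 2![apply: sos_sum => ?]; apply: sos_sqr.
move=> R phi; split=> [|v v0]; first by rewrite map_trmx sN.
pose f := @map_mx _ _ phi n n; pose w := (f L)^T *m v.
have cE : phi c = \sum_i \sum_j f T i j ^+ 2.
  rewrite rmorph_sum; apply: eq_bigr => i _; rewrite rmorph_sum.
  by apply: eq_bigr => j _; rewrite mxE rmorphXn.
have Tw : (f T)^T *m w = phi e *: v.
  by rewrite mulmxA -trmx_mul -map_mxM LT map_scalar_mx tr_scalar_mx mul_scalar_mx.
(* The transpose of [T] sends [w] to $e v$, and [e] maps to at least $1$. *)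
have v_le : sqnorm v <= phi c * sqnorm w.
  rewrite cE; apply: le_trans (sqnorm_mulmx_le _ _); rewrite Tw sqnormZ.
  by rewrite ler_peMl ?sqnorm_ge0 // exprn_ege1 // unit_sos_ge1.
have w_le : sqnorm w <= (v^T *m (phi s *: f M) *m v) 0 0.
  rewrite -map_mxZ sME !map_mxM -map_trmx map_diag_mx.
  have := @sqnorm_le_diag _ _ (map_mx phi d) w.
  rewrite trmx_mul trmxK !mulmxA; apply => i.
  by rewrite mxE unit_sos_ge1.
have c0 : 0 <= phi c.
  by rewrite cE; do 2![apply: sumr_ge0 => ? _]; apply: sqr_ge0.
rewrite map_mxB map_mxZ map_mx1 mulmxBr mulmxBl mulmx1 mxE [X in _ + X]mxE sqnormE.
rewrite rmorphM -scalerA -scalemxAr -scalemxAl mxE rmorphM rmorphD rmorph1.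
have v_gt0 := sqnorm_gt0 v0.
(* The form is at least $2|v|^2 - |v|^2 > 0$; the factor $2$ in the multiplier gives strictness. *)
have := ler_wpM2l c0 w_le; rewrite -/(f M).
set q := (_ *m _ *m v) 0 0; lra.
Qed.

Section Gram.
Variables (A : comPzRingType) (n : nat).
Implicit Types (X Y : 'M[A]_n).

Definition gram (m : nat) X := exists Q : 'M[A]_(m, n), X = Q^T *m Q.

Lemma gram0 : gram 0 0.
Proof. by exists 0; rewrite mulmx0. Qed.

Lemma gramD m m' X Y : gram m X -> gram m' Y -> gram (m + m') (X + Y).
Proof.
by move=> [Q ->] [Q' ->]; exists (col_mx Q Q'); rewrite tr_col_mx mul_row_col.
Qed.

Lemma gram_sum (I : finType) (m : I -> nat) (X : I -> 'M[A]_n) :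
  (forall i, gram (m i) (X i)) -> gram (\sum_i m i)%N (\sum_i X i).
Proof.
by move=> h; elim/big_rec2: _ => [|i Y k _ IH]; [apply: gram0|apply: gramD].
Qed.

Lemma gram_scale_col q (d : A) (u : 'cV[A]_n) :
  sum_of_q_squares q d -> gram q (d *: (u *m u^T)).
Proof.
case=> f ->; exists (\matrix_(l, j) (f l * u j 0)); apply/matrixP => i j.
rewrite !mxE big_ord1 !mxE mulr_suml; apply: eq_bigr => l _.
by rewrite !mxE; ring.
Qed.

(** $L D L^t$ is the sum of the outer squares of the columns of [L] weighted by the $d_i$; each
    takes as many rows as $d_i$ takes squares. *)
Lemma gram_diag (q : 'I_n -> nat) (L : 'M[A]_n) (d : 'rV[A]_n) :
  (forall i, sum_of_q_squares (q i) (d 0 i)) ->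
  gram (\sum_i q i)%N (L *m diag_mx d *m L^T).
Proof.
move=> h; have -> : L *m diag_mx d *m L^T = \sum_i d 0 i *: (col i L *m (col i L)^T).
  apply/matrixP => i j; rewrite mxE summxE; apply: eq_bigr => k _.
  by rewrite mul_mx_diag !mxE big_ord1 !mxE; ring.
by apply: gram_sum => i; apply: gram_scale_col.
Qed.

End Gram.

(** One function covers both cases: it is constantly $p(A)$ if this is finite, and otherwise picks a
    number of squares for each element. *)
Lemma squares_needed (A : comPzRingType) : exists q : A -> nat,
  (forall x, sum_of_squares x -> sum_of_q_squares (q x) x)
  /\ forall p, is_pythagoras_number A p -> forall x, q x = p.
Proof.
have [[p pA]|noP] := pselect (exists p, is_pythagoras_number A p).
  exists (fun _ => p); split=> [|p' p'A _]; first by case: pA.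
  by apply/eqP; rewrite eqn_leq pA.2 ?p'A.2 //; [case: pA|case: p'A].
have [q hq] : {q : A -> nat & forall x, sum_of_squares x -> sum_of_q_squares (q x) x}.
  apply: (@choice _ _ (fun x k => sum_of_squares x -> sum_of_q_squares k x)) => x.
  have [/sos_sum_of_q_squares[k hk]|nx] := pselect (sum_of_squares x); last by exists 0.
  by exists k.
by exists q; split=> // p pA; case: noP; exists p.
Qed.

Theorem theorem3p14 (A : comPzRingType) (n : nat) (M : 'M[A]_n) :
  symmetric_mx M -> pos_def M ->
  exists (m : nat) (s : A) (Q : 'M[A]_(m, n)),
    [/\ sum_of_squares s,
        s *: M = 1%:M + Q^T *m Q
      & forall p : nat, is_pythagoras_number A p -> (m <= 2 * n * p)%N].
Proof.
move=> sM pM; have [s [hs sN pN]] := pos_def_sub1 sM pM.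
have [r [e [d [L [_ [[t ht rE] _ ud rNE _]]]]]] := pos_def_LDL sN pN.
have [q [hq q_pyth]] := squares_needed A.
have Qd : gram (\sum_i q (d 0%R i))%N (L *m diag_mx d *m L^T).
  by apply: gram_diag => i; apply/hq/unit_sosW.
have Qt : gram (\sum_(i < n) q t)%N (t%:M : 'M[A]_n).
  have := @gram_diag A n (fun _ => q t) 1%:M (const_mx t).
  rewrite diag_const_mx mul1mx trmx1 mulmx1; apply => i.
  by rewrite mxE; apply: hq.
have [Q QE] := gramD Qt Qd.
exists (\sum_(i < n) q t + \sum_i q (d 0%R i))%N, (r * s), Q; split.
- by apply: sosM => //; apply: unit_sosW; exists t.
- rewrite -QE -rNE scalerBr scalerA rE scale_scalar_mx mulr1.
  by rewrite raddfD /= addrA addrCA subrr addr0.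
(* All counts equal [p], so both summands take [n * p] rows. *)
move=> p /q_pyth qp; rewrite qp (eq_bigr (fun=> p)) => [|i _]; last exact: qp.
by rewrite !sum_nat_const card_ord mul2n -addnn mulnDl.
Qed.
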